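(* Let $V=\mathbb{R}^2$ with coordinates $(p,q)$ and symplectic form $\omega=dp\wedge dq$, and let $\mathcal{O}=\{q>0\}\subset V$. The reduced Rankin–Cohen deformation $$u\star v=\sum_{n\ge0}\hbar^n RC_n(u,v),\qquad u,v\in C^\infty(\mathcal{O}),$$ realized on $\mathcal{O}$, coincides with the restriction to $\mathcal{O}$ of the standard Moyal product on $(V,\omega)$.
   Context: Write $(\alpha)_k=\alpha(\alpha+1)\cdots(\alpha+k-1)$, $(\alpha)_0=1$. For operators $X,Y$ with $[Y,X]=X$, $$RC_n(a,b)=\sum_{k=0}^n\frac{(-1)^k}{k!}X^k(2Y+k)_{n-k}(a)\;\frac{1}{(n-k)!}X^{n-k}(2Y+n-k)_k(b).$$ Realization on $\mathcal{O}$. Let $S=\{\exp(aH)\exp(\ell E)\}\subset SL(2,\mathbb{R})$ where $H,E,F$ is the standard basis of $\mathfrak{sl}_2(\mathbb{R})$ ($[H,E]=2E$, $[H,F]=-2F$, $[E,F]=H$). $S$ acts linearly on $V$ and acts simply transitively on $\mathcal{O}=S\cdot(0,1)$; the identification $S\cong\mathcal{O}$, $g\mapsto g\cdot(0,1)$, reads $p=e^a\ell$, $q=e^{-a}$. Let $\tilde H,\tilde E$ be the left-invariant vector fields on $S$ attached to $H,E$; in coordinates $\tilde H=\partial_a-2\ell\partial_\ell$, $\tilde E=\partial_\ell$, equivalently on $\mathcal{O}$: $\tilde H=-p\partial_p-q\partial_q$, $\tilde E=q^{-1}\partial_p$. One takes $2Y=\tilde H$ and $X=\tilde E$ in $RC_n$.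 The standard Moyal product with the parameter normalized so that its first order term is $\hbar\{u,v\}$, $\{u,v\}=\partial_pu\,\partial_qv-\partial_qu\,\partial_pv$, is $$u\star_M v=\sum_{n\ge0}\frac{\hbar^n}{n!}\sum_{r=0}^n(-1)^r\binom nr\,\partial_p^{n-r}\partial_q^ru\;\partial_p^r\partial_q^{n-r}v.$$ *)

(* Defs.v *)
From mathcomp Require Import all_boot all_order all_algebra.
From mathcomp Require Import all_classical all_reals all_analysis.

Set Implicit Arguments.
Unset Strict Implicit.
Unset Printing Implicit Defensive.

Import Order.TTheory GRing.Theory Num.Theory.
Import numFieldNormedType.Exports.
Local Open Scope classical_set_scope.
Local Open Scope ring_scope.

(* A function on an open set A is represented by a total function, of which
   only the values on A matter: since A is open, so do the values on A of all
   its derivatives. Likewise, equality of functions on A is pointwise on A. *)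
Fixpoint Ck (R : realType) (V : normedModType R) (k : nat) (A : set V)
    (f : V -> R) : Prop :=
  if k is k'.+1 then
    (forall x, A x -> differentiable f x) /\ (forall v, Ck k' A ('D_v f))
  else forall x, A x -> {for x, continuous f}.

Definition Cinfty (R : realType) (V : normedModType R) (A : set V)
    (f : V -> R) : Prop := forall k, Ck k A f.

Section Rankin_Cohen.
Context {R : realType} {T : Type}.
Implicit Types (Z X Y : (T -> R) -> T -> R) (a b : T -> R).

Definition op_scale (c : R) Z : (T -> R) -> T -> R := fun a x => c * Z a x.

Definition op_shift Z (c : R) : (T -> R) -> T -> R :=
  fun a x => Z a x + c * a x.

Definition op_poch Z (m : nat) : (T -> R) -> T -> R :=
  \big[comp/idfun]_(i < m) op_shift Z i%:R.

Definition RC X Y (n : nat) a b : T -> R := fun x =>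
  \sum_(k < n.+1)
    (-1) ^+ k / k`!%:R
      * iter k X (op_poch (op_shift (op_scale 2 Y) k%:R) (n - k) a) x
      * ((n - k)`!%:R^-1
          * iter (n - k) X
              (op_poch (op_shift (op_scale 2 Y) (n - k)%:R) k b) x).

End Rankin_Cohen.

Section Realization.
Variable R : realType.

Definition expmx (A : 'M[R]_2) : 'M[R]_2 :=
  limn (series (fun k => k`!%:R^-1 *: A ^+ k)).

Definition sl2H : 'M[R]_2 := delta_mx 0 0 - delta_mx 1 1.
Definition sl2E : 'M[R]_2 := delta_mx 0 1.

Definition grpS : set 'M[R]_2 :=
  [set g | exists a l : R, g = expmx (a *: sl2H) *m expmx (l *: sl2E)].

(* V is the plane of columns (p, q)^T, on which S acts by multiplication. *)
Definition e_p : 'cV[R]_2 := delta_mx 0 0.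
Definition e_q : 'cV[R]_2 := delta_mx 1 0.

Definition half_plane : set 'cV[R]_2 := [set x | 0 < x 1 0].

Definition orb (g : 'M[R]_2) : 'cV[R]_2 := g *m e_q.

(* Inverse of the identification g |-> g . (0, 1) of S with its orbit {q > 0}. *)
Definition orb_inv (x : 'cV[R]_2) : 'M[R]_2 :=
  xget 1 [set g | grpS g /\ orb g = x].

Definition left_invariant (A : 'M[R]_2) (f : 'M[R]_2 -> R) : 'M[R]_2 -> R :=
  fun g => derive1 (fun t : R => f (g *m expmx (t *: A))) 0.

Definition orbit_field (A : 'M[R]_2) (u : 'cV[R]_2 -> R) : 'cV[R]_2 -> R :=
  left_invariant A (u \o orb) \o orb_inv.

Definition opX : ('cV[R]_2 -> R) -> 'cV[R]_2 -> R := orbit_field sl2E.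
Definition opY : ('cV[R]_2 -> R) -> 'cV[R]_2 -> R :=
  op_scale 2^-1 (orbit_field sl2H).

(* Formal power series in hbar with coefficients in functions, encoded by
   their sequences of coefficients. *)
Definition hseries : Type := nat -> 'cV[R]_2 -> R.

Definition eq_hseries_on (A : set 'cV[R]_2) (s t : hseries) : Prop :=
  forall n x, A x -> s n x = t n x.

Definition RC_star (u v : 'cV[R]_2 -> R) : hseries :=
  fun n => RC opX opY n u v.

Definition dp : ('cV[R]_2 -> R) -> 'cV[R]_2 -> R := fun u => 'D_e_p u.
Definition dq : ('cV[R]_2 -> R) -> 'cV[R]_2 -> R := fun u => 'D_e_q u.

Definition moyal_star (u v : 'cV[R]_2 -> R) : hseries := fun n x =>
  n`!%:R^-1 * \sum_(r < n.+1)
    (-1) ^+ r * 'C(n, r)%:R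
      * iter (n - r) dp (iter r dq u) x
      * iter r dp (iter (n - r) dq v) x.

End Realization.

(* Main.v *)
(* On the half plane, [X] is [q^-1 dp] and [2 Y] is minus the Euler operator
   [p dp + q dq]. As [dp] and [dq] lower the degree of homogeneity by one,
   [dp^k (2Y + k)_m = (-1)^m sum_i 'C(m, i) p^(m-i) q^i dp^(m-i+k) dq^i].
   Hence [RC_n u v] is a combination of the products of [dp^(n-i) dq^i u] and
   [dp^(n-j) dq^j v], and summing over [k] their coefficients one finds a
   multiple of [(1 - 1)^(n-i-j)]: only the terms with [i + j = n] survive, and
   these form the Moyal product. *)
From HB Require Import structures.
Require Import Defs.
From mathcomp Require Import all_boot all_order all_algebra.
From mathcomp Require Import all_classical all_reals all_analysis.
From mathcomp Require Import ring lra zify.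

Import Order.TTheory GRing.Theory Num.Theory.
Import numFieldNormedType.Exports.
Local Open Scope classical_set_scope.
Local Open Scope ring_scope.

(** * Symmetry of second derivatives and smooth functions *)

Section Smooth.
Context {R : realType} {V : normedModType R}.
Implicit Types (f g : V -> R) (A : set V) (v w x : V).

(** The two difference quotients are the same function of [h], so derivability in the one direction
    [v] suffices. *)
Lemma is_derive_line f y v (s : R) : derivable f (y + s *: v) v ->
  is_derive s 1 (fun t => f (y + t *: v)) ('D_v f (y + s *: v)).
Proof.
have E : (fun h : R => h^-1 *: (((fun t => f (y + t *: v)) \o shift s) (h *: 1)
            - f (y + s *: v)))
       = (fun h : R => h^-1 *: ((f \o shift (y + s *: v)) (h *: v) - f (y + s *: v))).
  by apply/funext => h; rewrite /= [_%:A]mulr1 scalerDl addrCA.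
by move=> fv; apply: DeriveDef; rewrite /derivable /derive E.
Qed.

(* With [g := 'D_v f], the mean value theorem applied to
   [s |-> f (x + s v + t w) - f (x + s v)] turns the second difference into
   [t (g (x + c v + t w) - g (x + c v))] for some [0 < c < t]. *)
Lemma second_difference_le f v w x (e : R) : 0 < e ->
  (\forall y \near x, differentiable f y) -> differentiable ('D_v f) x ->
  \forall t \near 0^'+,
    `|f (x + t *: v + t *: w) - f (x + t *: v) - f (x + t *: w) + f x
      - t ^+ 2 * 'D_w ('D_v f) x| <= e * t ^+ 2.
Proof.
move=> e0 fd gd; set g := 'D_v f in gd *.
(* The first-order errors at two points within [t * (|v| + |w|)] of [x] must add up to at most
   [e * t]; the [+ 1] keeps [M] positive when [v = w = 0]. *)
pose M := 2 * (`|v| + `|w|) + 1.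
have M0 : 0 < M by rewrite ltr_wpDl// mulr_ge0// addr_ge0.
have near_g : \forall y \near x,
    `|g y - g x - 'd g x (y - x)| <= e / M * `|y - x|.
  have := diff_locally gd => /eqaddoP/(_ _ (divr_gt0 e0 M0)).
  rewrite [\forall x \near _, _ <= _](near_shift x) sub0r; apply: filterS => y /=.
  have -> : (g \o +%R^~ x - (cst (g x) + 'd g x)) (y - x)
    = g (y - x + x) - (g x + 'd g x (y - x)) by [].
  by rewrite subrK opprD addrA.
have [d /= d0 Hd] : exists2 d : R, 0 < d & forall y, `|y - x| < d ->
    differentiable f y /\ `|g y - g x - 'd g x (y - x)| <= e / M * `|y - x|.
  have [d /= d0 Hd] := (@nbhs_ballP _ _ x _).1 (filterI fd near_g).
  exists d => // y yd; apply: Hd; rewrite -ball_normE /= distrC//.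
near=> t.
have t0 : 0 < t by near: t; exact: nbhs_right_gt.
have tM : t * M < d.
  rewrite -ltr_pdivlMr//; near: t; apply: nbhs_right_lt; exact: divr_gt0.
pose phi s := f (x + s *: v + t *: w) - f (x + s *: v).
have small a b : 0 <= a <= t -> 0 <= b <= t ->
    `|(x + a *: v + b *: w) - x| <= t * (`|v| + `|w|).
  move=> /andP[a0 ta] /andP[b0 tb]; rewrite -[x + _ + _]addrA (addrC x) addrK.
  rewrite (le_trans (ler_normD _ _))// !normrZ !ger0_norm// mulrDr.
  by rewrite lerD// ler_wpM2r.
have tvw : t * (`|v| + `|w|) < d.
  apply: le_lt_trans tM; rewrite ler_pM2l// /M.
  by have := normr_ge0 v; have := normr_ge0 w; lra.
have inb a b : 0 <= a <= t -> 0 <= b <= t ->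
    `|(x + a *: v + b *: w) - x| < d.
  by move=> ? ?; apply: le_lt_trans tvw; exact: small.
have t0t : 0 <= t <= t by apply/andP; split=> //; exact: ltW.
have z0t : 0 <= (0 : R) <= t by apply/andP; split=> //; exact: ltW.
have phiD s : 0 <= s <= t ->
    is_derive s 1 phi (g (x + s *: v + t *: w) - g (x + s *: v)).
  move=> s0t.
  have -> : phi = (fun s => f (x + t *: w + s *: v)) - (fun s => f (x + s *: v)).
    by apply/funext => r; rewrite /phi (addrAC x).
  rewrite (addrAC x).
  apply: is_deriveB; apply: is_derive_line; apply: diff_derivable.
    by rewrite (addrAC x); have [] := Hd _ (inb _ _ s0t t0t).
  by have := inb _ _ s0t z0t; rewrite scale0r addr0 => /Hd[].
have [c ct phiE] : exists2 c, c \in `]0, t[ & phi t - phi 0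
    = (g (x + c *: v + t *: w) - g (x + c *: v)) * (t - 0).
  apply: (@MVT _ phi (fun c => (g (x + c *: v + t *: w) - g (x + c *: v)))) => //.
    move=> s; rewrite in_itv/= => /andP[s0 st]; apply: phiD; rewrite !ltW//.
  apply: derivable_within_continuous => s; rewrite in_itv/= => st.
  by have [] := phiD _ st.
move: ct; rewrite in_itv/= => /andP[c0 ct].
have c0t : 0 <= c <= t by rewrite !ltW.
have -> : f (x + t *: v + t *: w) - f (x + t *: v) - f (x + t *: w) + f x
   = t * (g (x + c *: v + t *: w) - g (x + c *: v)).
  by rewrite mulrC -[X in _ * X]subr0 -phiE /phi !scale0r !addr0; ring.
rewrite deriveE//.
have [_ H1] := Hd _ (inb _ _ c0t t0t).
have [_ H2] := Hd _ (inb _ _ c0t z0t).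
have S1 := small _ _ c0t t0t.
have S2 := small _ _ c0t z0t.
set P := x + c *: v + t *: w in H1 S1 *.
rewrite scale0r addr0 in H2 S2; set Q := x + c *: v in H2 S2 *.
(* As [P - Q = t *: w], the linear parts leave the main term, divided by [t]. *)
have PQ : 'd g x (P - x) - 'd g x (Q - x) = t * 'd g x w.
  rewrite -linearB /P /= -/Q opprB addrA subrK addrAC subrr add0r.
  by rewrite linearZ.
rewrite expr2 -mulrA -mulrBr normrM gtr0_norm// mulrCA ler_pM2l//.
rewrite -PQ.
have -> : g P - g Q - ('d g x (P - x) - 'd g x (Q - x)) =
   (g P - g x - 'd g x (P - x)) - (g Q - g x - 'd g x (Q - x)) by lra.
rewrite (le_trans (ler_normB _ _))// (le_trans (lerD H1 H2))// -mulrDr.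
rewrite -mulrA ler_pM2l// ler_pdivrMl// (le_trans (lerD S1 S2))// /M mulrC.
by lra.
Unshelve. all: by end_near.
Qed.

(** The second difference is symmetric in [v] and [w], so for each [e] a single small [t] puts both
    mixed derivatives within [e / 2] of its quotient by [t ^+ 2]. *)
Lemma derive_comm f v w x :
  (\forall y \near x, differentiable f y) ->
  differentiable ('D_v f) x -> differentiable ('D_w f) x ->
  'D_w ('D_v f) x = 'D_v ('D_w f) x.
Proof.
move=> fd vd wd; apply/eqP; rewrite -subr_eq0 -normr_le0; apply/ler_addgt0Pl => e e0.
have e2 : 0 < e / 2 by rewrite divr_gt0.
have [t [[H1 H2] t0]] := filter_ex (filterI
  (filterI (second_difference_le f v w x _ e2 fd vd)
           (second_difference_le f w v x _ e2 fd wd)) (nbhs_right_gt 0)).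
have t2 : 0 < t ^+ 2 by rewrite exprn_gt0.
rewrite (addrAC x (t *: w)) in H2.
set a := f (x + _ + _) in H1 H2; rewrite (addrAC a (- f (x + t *: w))) in H2.
move: H1 H2 => /ler_normlP[H1 H2] /ler_normlP[H3 H4].
rewrite addr0 -(ler_pM2r t2) -[in X in X <= _](gtr0_norm t2) -normrM ler_norml.
move: H1 H2 H3 H4; move: ('D_w _ _) ('D_v _ _) (t ^+ 2) => D1 D2 T.
move: (f (x + t *: v)) (f (x + t *: w)) => b c H1 H2 H3 H4.
by apply/andP; split; lra.
Qed.
End Smooth.

(** The first-order expansion of [f] at [x] is also one for [g], with the same linear part. *)
Lemma near_eq_differentiable (R : realType) (V : normedModType R) (f g : V -> R) x :
  (\near x, f x = g x) -> differentiable f x -> differentiable g x.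
Proof.
move=> fg /diff_locallyP[dc fE].
have gE : g \o shift x = cst (g x) + 'd f x +o_ 0 id.
  apply/eqaddoP => e e0; move: fE => /eqaddoP/(_ _ e0).
  have fg0 : \forall h \near 0, f (h + x) = g (h + x).
    by move: fg; rewrite [\forall y \near _, _ = _](near_shift 0)/= subr0.
  apply: filterS2 fg0 => h fgh.
  have -> : (f \o shift x - (cst (f x) + 'd f x)) h
    = f (h + x) - (f x + 'd f x h) by [].
  have -> : (g \o shift x - (cst (g x) + 'd f x)) h
    = g (h + x) - (g x + 'd f x h) by [].
  by rewrite fgh (nbhs_singleton fg).
have dE : 'd g x = 'd f x :> (V -> R) by exact: diff_unique.
by apply/diff_locallyP; rewrite dE.
Qed.

(** * Stability of [Ck] on an open set *)

Section Ck.
Context {R : realType} {V : normedModType R} (A : set V).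
Hypothesis Aop : open A.
Implicit Types (f g : V -> R) (v w x : V) (k : nat).

Lemma near_open (P : V -> Prop) x : A x -> (forall y, A y -> P y) ->
  \forall y \near x, P y.
Proof. by move=> Ax AP; apply: (filterS AP); exact: open_nbhs_nbhs. Qed.

Lemma eq_on_derive f g v : (forall x, A x -> f x = g x) ->
  forall x, A x -> 'D_v f x = 'D_v g x.
Proof. by move=> fg x Ax; apply: near_eq_derive; exact: near_open. Qed.

(** Rules of differentiation give derivatives on [A] only; this congruence carries them into
    [Ck]. *)
Lemma eq_on_Ck k f g : (forall x, A x -> f x = g x) -> Ck k A f -> Ck k A g.
Proof.
elim: k f g => [|k IH] f g fg /=.
  move=> fc x Ax; apply: cvg_trans (_ : f y @[y --> x] --> g x).
    apply: near_eq_cvg; exact: near_open.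
  by rewrite -fg//; exact: fc.
move=> [fd fk]; split=> [x Ax|v].
  by apply: near_eq_differentiable (fd x Ax); exact: near_open.
by apply: IH (fk v); exact: eq_on_derive.
Qed.

Lemma CkS k f : Ck k.+1 A f -> Ck k A f.
Proof.
elim: k f => [|k IH] f [fd fk].
  by move=> x Ax; exact/differentiable_continuous/fd.
by split=> // v; exact: IH.
Qed.

Lemma CkD k f g : Ck k A f -> Ck k A g -> Ck k A (f \+ g).
Proof.
elim: k f g => [|k IH] f g /=.
  by move=> fc gc x Ax; apply: continuousD; [exact: fc|exact: gc].
move=> [fd fk] [gd gk]; split=> [x Ax|v].
  by apply: differentiableD; [exact: fd|exact: gd].
apply: eq_on_Ck (IH _ _ (fk v) (gk v)) => x Ax /=.
by rewrite deriveD//; apply: diff_derivable; [exact: fd|exact: gd].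
Qed.

Lemma CkZ k c f : Ck k A f -> Ck k A (c \*o f).
Proof.
elim: k f => [|k IH] f /=.
  by move=> fc x Ax; apply: continuousM; [exact: cst_continuous|exact: fc].
move=> [fd fk]; split=> [x Ax|v].
  by apply: (@differentiableZ _ _ _ f); exact: fd.
apply: eq_on_Ck (IH _ (fk v)) => x Ax /=.
by rewrite (@deriveZ _ _ _ f)//; apply: diff_derivable; exact: fd.
Qed.

(** The hypothesis makes [l] its own differential, hence linear. In the Leibniz rule [l v] is then a
    constant, so the induction uses only sums and scalings. This covers the coordinate coefficients
    of the Euler operator. *)
Lemma Ck_mul_linear k (l : V -> R) f : (forall x, is_diff x l l) ->
  Ck k A f -> Ck k A (l \* f).
Proof.
move=> ll; elim: k f => [|k IH] f /=.
  move=> fc x Ax; apply: continuousM; last exact: fc.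
  exact: differentiable_continuous.
move=> [fd fk]; split=> [x Ax|v].
  by apply: differentiableM => //; exact: fd.
apply: (eq_on_Ck _ (l v \*o f \+ l \* 'D_v f)) => [x Ax /=|].
  rewrite (@deriveM _ _ l f); last 2 first.
  - exact: diff_derivable.
  - by apply: diff_derivable; exact: fd.
  by case: (ll x) => ld dl; rewrite [in RHS](deriveE _ ld) dl addrC [f x *: _]mulrC.
apply: CkD; last exact: IH.
by apply: CkZ; apply: CkS; split.
Qed.

Lemma Cinfty_diff f x : Cinfty A f -> A x -> differentiable f x.
Proof. by move=> fs Ax; case: (fs 1%N) => fd _; exact: fd. Qed.

Lemma Cinfty_derive f v : Cinfty A f -> Cinfty A ('D_v f).
Proof. by move=> fs k; have [_] := fs k.+1; apply. Qed.

Lemma Cinfty_derive_comm f v w x : Cinfty A f -> A x ->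
  'D_w ('D_v f) x = 'D_v ('D_w f) x.
Proof.
move=> fs Ax; apply: derive_comm.
- by apply: near_open => // y; exact: Cinfty_diff.
- by apply: Cinfty_diff => //; exact: Cinfty_derive.
- by apply: Cinfty_diff => //; exact: Cinfty_derive.
Qed.

End Ck.

(** * The vector fields of S on the half plane *)

Section Exp.
Variable R : realType.
Implicit Types (a l t : R).

Lemma sl2H_expr a k : (a *: sl2H R) ^+ k =
  a ^+ k *: delta_mx 0 0 + (- a) ^+ k *: delta_mx 1 1.
Proof.
elim: k => [|k IH].
  rewrite !expr0 !scale1r; apply/matrixP => i j.
  by rewrite !mxE; case: i j => [[|[|//]] ?] [[|[|//]] ?] //=; rewrite ?addr0 ?add0r.
rewrite exprS IH /sl2H -!mulmxE scalerBr mulmxDr !mulmxBl.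
rewrite -!scalemxAl -!scalemxAr !mul_delta_mx_cond /= !mulr1n !mulr0n !scaler0 subr0 sub0r.
by rewrite !scalerA -exprS -scaleNr -mulNr -exprS.
Qed.

Lemma expmx_sl2H a : expmx (a *: sl2H R) =
  expR a *: delta_mx 0 0 + expR (- a) *: delta_mx 1 1.
Proof.
rewrite /expmx; apply: cvg_lim; first exact: norm_hausdorff.
rewrite (_ : series _ = fun n => series (exp_coeff a) n *: delta_mx 0 0
   + series (exp_coeff (- a)) n *: delta_mx 1 1); last first.
  apply/funext => n; rewrite /series/= !scaler_suml -big_split; apply: eq_bigr => k _.
  by rewrite sl2H_expr scalerDr !scalerA /exp_coeff/= ![_^-1 * _]mulrC.
by apply: cvgD; apply: cvgZr_tmp; exact: is_cvg_series_exp_coeff.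
Qed.

Lemma expmx_sl2E l : expmx (l *: sl2E R) = 1 + l *: delta_mx 0 1.
Proof.
rewrite /expmx; apply: cvg_lim; first exact: norm_hausdorff.
(* [sl2E] squares to zero, so the partial sums are constant from index 2 on. *)
apply: cvg_near_cst; exists 2%N => // n /= n2.
rewrite /series/= -(subnK n2) addn2 2?big_nat_recl//=.
rewrite big1 => [|k _]; last first.
  rewrite 2!exprSr -mulrA (_ : _ *: _ * (l *: _) = 0) ?mulr0 ?scaler0//.
  by rewrite -mulmxE -scalemxAl -scalemxAr mul_delta_mx_cond /= mulr0n !scaler0.
by rewrite expr0 expr1 fact0 (_ : 1`! = 1%N)// !invr1 !scale1r addr0.
Qed.

End Exp.

(** * The orbit map and the operators it induces *)

Section OrbitFields.
Variable R : realType.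
Implicit Types (x : 'cV[R]_2) (u : 'cV[R]_2 -> R).
Local Notation A := (@half_plane R).

Lemma open_half_plane : open A.
Proof.
apply: (@open_comp _ _ (fun x : 'cV[R]_2 => x 1 0) [set y | 0 < y]); last exact: open_gt.
by move=> x _; exact: coord_continuous.
Qed.

Lemma cV2E x : x = x 0 0 *: e_p R + x 1 0 *: e_q R.
Proof.
apply/colP => i; rewrite !mxE.
by case: i => [[|[|//]] ?] /=; rewrite ?mulr0 ?mulr1 ?addr0 ?add0r;
  congr (x _ _); apply: val_inj.
Qed.

Lemma expmxH_act a x : expmx (a *: sl2H R) *m x =
  (expR a * x 0 0) *: e_p R + (expR (- a) * x 1 0) *: e_q R.
Proof.
rewrite expmx_sl2H [in LHS](cV2E x) mulmxDl !mulmxDr -!scalemxAl -!scalemxAr.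
rewrite !mul_delta_mx_cond /= !mulr1n !mulr0n !scaler0 addr0 add0r.
by rewrite !scalerA.
Qed.

Lemma expmxE_act l x : expmx (l *: sl2E R) *m x = x + (l * x 1 0) *: e_p R.
Proof.
rewrite expmx_sl2E mulmxDl mul1mx; congr (_ + _).
rewrite [in LHS](cV2E x) !mulmxDr -!scalemxAl -!scalemxAr.
by rewrite !mul_delta_mx_cond /= !mulr1n !mulr0n !scaler0 add0r scalerA.
Qed.

(** An element [exp(aH) exp(lE)] sends [e_q] to [(e^a l, e^-a)] and [e_p] to [(e^a, 0)]: its value
    on [e_q] fixes the one on [e_p], whichever element [xget] picks. *)
Lemma orb_invP x : A x ->
  orb (orb_inv x) = x /\ orb_inv x *m e_p R = (x 1 0)^-1 *: e_p R.
Proof.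
move=> xq; rewrite /half_plane/= in xq.
have act a l : (expmx (a *: sl2H R) *m expmx (l *: sl2E R)) *m e_q R =
    (expR a * l) *: e_p R + expR (- a) *: e_q R.
  by rewrite -mulmxA expmxE_act expmxH_act !mxE /= !mulr1 !mulr0 !add0r addr0 mulr1.
have actp a l : (expmx (a *: sl2H R) *m expmx (l *: sl2E R)) *m e_p R =
    expR a *: e_p R.
  by rewrite -mulmxA expmxE_act expmxH_act !mxE /=
    !mulr0 !mul0r !addr0 mulr0 mulr1 scale0r addr0.
have [] : grpS (orb_inv x) /\ orb (orb_inv x) = x.
  apply: (@xgetPex _ 1 [set g | grpS g /\ orb g = x]).
  (* Solves [e^-a = q] and [e^a l = p]. *)
  exists (expmx (- ln (x 1 0) *: sl2H R) *m expmx ((x 1 0 * x 0 0) *: sl2E R)).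
  split; first by exists (- ln (x 1 0)), (x 1 0 * x 0 0).
  rewrite /orb act expRN opprK lnK// mulKf ?gt_eqF//; exact/esym/cV2E.
move=> [a [l gE]]; rewrite /orb gE act actp => xE; split => //.
by rewrite -[in RHS]xE !mxE /= mulr0 add0r mulr1 -expRN opprK.
Qed.

(** [exp(tE)] moves [e_q] to [e_q + t e_p] before [orb_inv x] acts. *)
Lemma orb_flowE x t : A x ->
  orb (orb_inv x *m expmx (t *: sl2E R)) = x + t *: ((x 1 0)^-1 *: e_p R).
Proof.
move=> Ax; have [xE xp] := orb_invP _ Ax.
by rewrite /orb -mulmxA expmxE_act mulmxDr -/(orb _) xE -scalemxAr xp !mxE /= mulr1.
Qed.

(** [e_q] is an eigenvector of [exp(tH)], so the flow consists of dilations. *)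
Lemma orb_flowH x t : A x ->
  orb (orb_inv x *m expmx (t *: sl2H R)) = expR (- t) *: x.
Proof.
move=> Ax; have [xE _] := orb_invP _ Ax.
rewrite /orb -mulmxA expmxH_act !mxE /= mulr0 mulr1 scale0r add0r -scalemxAr.
by rewrite -/(orb _) xE.
Qed.

(* [X] differentiates along the lines on which [q] is constant. *)
Lemma opXE (phi : R -> R) f g x : (forall y, A y -> f y = phi (y 1 0) * g y) ->
  differentiable g x -> A x -> opX f x = phi (x 1 0) * ((x 1 0)^-1 * dp g x).
Proof.
move=> fg gx Ax; rewrite /opX /orbit_field /left_invariant /=.
set v := (x 1 0)^-1 *: e_p R.
have row1 t : (x + t *: v) 1 0 = x 1 0 by rewrite !mxE /= !mulr0 addr0.
have -> : (fun t : R => f (orb (orb_inv x *m expmx (t *: sl2E R))))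
    = phi (x 1 0) \*o (fun t : R => g (x + t *: v)).
  by apply/funext => t; rewrite orb_flowE// fg /half_plane /= row1.
have gv : is_derive (0 : R) 1 (fun t : R => g (x + t *: v)) ('D_v g x).
  have := @is_derive_line R _ g x v 0; rewrite scale0r addr0; apply.
  exact: diff_derivable.
rewrite derive1E (@deriveZ _ _ _ (fun t : R => g (x + t *: v)))// derive_val.
by rewrite /dp !deriveE// /v linearZ.
Qed.

(** The chain rule along the dilations gives minus the derivative of [g] at [x] in the direction [x]
    itself. A second function [g] appears because iterates of the operators are known by formulas on
    the half plane only. *)
Lemma orbit_fieldHE f g x : (forall y, A y -> f y = g y) ->
  differentiable g x -> A x ->
  orbit_field (sl2H R) f x = - (x 0 0 * dp g x + x 1 0 * dq g x).
Proof.
move=> fg gx Ax; rewrite /orbit_field /left_invariant /=.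
have -> : (fun t : R => f (orb (orb_inv x *m expmx (t *: sl2H R))))
    = (fun s : R => g (s *: x)) \o (expR \o -%R).
  apply/funext => t; rewrite orb_flowH// fg /half_plane //= mxE mulr_gt0//.
  exact: expR_gt0.
have g1 : is_derive (expR (- (0 : R))) 1 (fun s : R => g (s *: x)) ('D_x g x).
  have := @is_derive_line R _ g 0 x 1; rewrite oppr0 expR0 scale1r add0r.
  under eq_fun do rewrite add0r.
  by apply; exact: diff_derivable.
rewrite derive1E derive_val /= oppr0 expR0.
have -> : 'D_x g x = x 0 0 * dp g x + x 1 0 * dq g x.
  rewrite /dp /dq !(deriveE _ gx) -[x 0 0 * _]linearZ -[x 1 0 * _]linearZ.
  by rewrite -linearD -cV2E.
by rewrite mul1r mulrN1.
Qed.
End OrbitFields.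

(** * Rising factorials of the Euler operator *)

(** Pascal's rule, in the shape of the induction step of [iter_dp_euler_poch]. *)
Lemma sum_binS (K : comNzRingType) (p q : K) (a : nat -> K) m :
  \sum_(i < m.+2) 'C(m.+1, i)%:R * p ^+ (m.+1 - i) * q ^+ i * a i
  = \sum_(i < m.+1) ('C(m, i)%:R * p ^+ (m.+1 - i) * q ^+ i * a i
      + 'C(m, i)%:R * p ^+ (m - i) * q ^+ i.+1 * a i.+1).
Proof.
pose F i := 'C(m, i)%:R * p ^+ (m.+1 - i) * q ^+ i * a i.
have F0 : F m.+1 = 0 by rewrite /F bin_small// !mul0r.
have -> : \sum_(i < m.+1) ('C(m, i)%:R * p ^+ (m.+1 - i) * q ^+ i * a i
      + 'C(m, i)%:R * p ^+ (m - i) * q ^+ i.+1 * a i.+1)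
    = \sum_(i < m.+2) F i
      + \sum_(i < m.+1) 'C(m, i)%:R * p ^+ (m - i) * q ^+ i.+1 * a i.+1.
  by rewrite big_split [in RHS]big_ord_recr /= F0 addr0.
rewrite !(big_ord_recl m.+1) -addrA /F !bin0; congr (_ + _); rewrite -big_split /=.
by apply: eq_bigr => i _; rewrite /bump !add1n binS natrD !mulrDl subSS.
Qed.

Section EulerOperators.
Variable R : realType.
Implicit Types (x v : 'cV[R]_2) (f g u : 'cV[R]_2 -> R) (c : R).
Local Notation A := (@half_plane R).
Let Aop := @open_half_plane R.

Lemma is_diff_coord i x : is_diff x (fun y : 'cV[R]_2 => y i 0) (fun y => y i 0).
Proof.
have @l : {linear 'cV[R]_2 -> R}.
  by exists (fun N : 'cV[R]_2 => N i 0); do 2![eexists]; do ?[constructor];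
     rewrite ?mxE// => ? *; rewrite ?mxE//; move=> ?; rewrite !mxE.
have lc : continuous l by exact: coord_continuous.
apply: DiffDef; first exact: (linear_differentiable x lc).
exact: (diff_lin x lc).
Qed.

(** The mixed derivative of order [(r, s)], with [q]-derivatives taken first as in [moyal_star]. *)
Definition pd r s f : 'cV[R]_2 -> R := iter r (@dp R) (iter s (@dq R) f).

Lemma Cinfty_pd r s f : Cinfty A f -> Cinfty A (pd r s f).
Proof.
move=> fs; rewrite /pd; elim: r => [|r IH] /=; last exact: Cinfty_derive.
by elim: s => [|s IH] //=; exact: Cinfty_derive.
Qed.

Lemma eq_on_iter_derive r v f g : (forall x, A x -> f x = g x) ->
  forall x, A x -> iter r (fun h => 'D_v h) f x = iter r (fun h => 'D_v h) g x.
Proof. by move=> fg; elim: r => //= r IH; exact: (eq_on_derive _ Aop _ _ v IH). Qed.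

(** Symmetry of second derivatives moves [dq] through every [dp]. *)
Lemma dq_pd r s f x : Cinfty A f -> A x -> dq (pd r s f) x = pd r s.+1 f x.
Proof.
move=> fs; elim: r x => [//|r IH] x Ax.
rewrite [LHS](Cinfty_derive_comm _ Aop)//; last exact: Cinfty_pd.
exact: (eq_on_derive _ Aop _ _ (e_p R) IH).
Qed.

(** [2 Y + c] on the half plane, [2 Y] being minus the Euler operator. *)
Definition euler_shift c g x : R := c * g x - (x 0 0 * dp g x + x 1 0 * dq g x).

Lemma Cinfty_euler_shift c g : Cinfty A g -> Cinfty A (euler_shift c g).
Proof.
move=> gs k.
apply: (eq_on_Ck _ Aop _ (c \*o g \+ (-1) \*o
   ((fun y : 'cV[R]_2 => y 0 0) \* dp g \+ (fun y : 'cV[R]_2 => y 1 0) \* dq g))).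
  by move=> x _; rewrite /euler_shift /= mulN1r.
apply: CkD => //; first exact: CkZ.
apply: CkZ => //; apply: CkD => //; apply: Ck_mul_linear => //;
  by [move=> ?; exact: is_diff_coord|exact: Cinfty_derive].
Qed.

(** The commutator of ['D_v] with the Euler operator is ['D_v], which the last term writes in
    coordinates. *)
Lemma derive_euler_shift c g v x : Cinfty A g -> A x ->
  'D_v (euler_shift c g) x
  = euler_shift c ('D_v g) x - (v 0 0 * dp g x + v 1 0 * dq g x).
Proof.
move=> gs Ax.
have cD i : is_derive x v (fun y : 'cV[R]_2 => y i 0) (v i 0).
  case: (is_diff_coord i x) => cd cv; apply: DeriveDef; first exact: diff_derivable.
  by rewrite deriveE// cv.
have D h : Cinfty A h -> is_derive x v h ('D_v h x).
  by move=> hs; apply/derivableP/diff_derivable; apply: Cinfty_diff hs Ax.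
have gD := D _ gs.
have pD := D _ (Cinfty_derive _ _ (e_p R) gs).
have qD := D _ (Cinfty_derive _ _ (e_q R) gs).
have := is_deriveB (is_deriveZ c gD)
  (is_deriveD (is_deriveM (cD 0) pD) (is_deriveM (cD 1) qD)).
move=> /(@derive_val _ _ _ _ _ _ _) H.
rewrite (_ : euler_shift c g = c \*: g - ((fun y : 'cV[R]_2 => y 0 0) * 'D_(e_p R) g
  + (fun y : 'cV[R]_2 => y 1 0) * 'D_(e_q R) g)); last by apply/funext.
rewrite H /euler_shift /dp /dq.
rewrite (Cinfty_derive_comm _ Aop _ (e_p R) v _ gs Ax).
rewrite (Cinfty_derive_comm _ Aop _ (e_q R) v _ gs Ax).
rewrite /GRing.scale /=.
move: ('D_(e_p R) _ x) ('D_(e_q R) _ x) ('D_v g x) => X Y Z.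
ring.
Qed.

Lemma eq_on_euler_shift c f g x : (forall y, A y -> f y = g y) -> A x ->
  euler_shift c f x = euler_shift c g x.
Proof.
move=> fg Ax; rewrite /euler_shift fg//.
by rewrite /dp /dq !(eq_on_derive _ Aop _ _ _ fg _ Ax).
Qed.

(** For [v = e_p] the commutator term is one more [dp], absorbed by lowering the constant by one. *)
Lemma iter_dp_euler_shift r c g x : Cinfty A g -> A x ->
  iter r (@dp R) (euler_shift c g) x = euler_shift (c - r%:R) (iter r (@dp R) g) x.
Proof.
move=> gs; elim: r x => [|r IH] x Ax; first by rewrite subr0.
rewrite [LHS](eq_on_derive _ Aop _ _ _ IH)// derive_euler_shift//;
  last exact: (Cinfty_pd r 0).
rewrite !mxE /= mul1r mul0r addr0 /euler_shift -natr1 /dp; ring.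
Qed.

Lemma iter_dq_euler_shift r c g x : Cinfty A g -> A x ->
  iter r (@dq R) (euler_shift c g) x = euler_shift (c - r%:R) (iter r (@dq R) g) x.
Proof.
move=> gs; elim: r x => [|r IH] x Ax; first by rewrite subr0.
rewrite [LHS](eq_on_derive _ Aop _ _ _ IH)// derive_euler_shift//;
  last exact: (Cinfty_pd 0 r).
rewrite !mxE /= mul1r mul0r add0r /euler_shift -natr1 /dq; ring.
Qed.

Lemma pd_euler_shift r s c g x : Cinfty A g -> A x ->
  pd r s (euler_shift c g) x = euler_shift (c - (r + s)%:R) (pd r s g) x.
Proof.
move=> gs Ax; rewrite /pd.
have E y : A y -> iter s (@dq R) (euler_shift c g) y
    = euler_shift (c - s%:R) (iter s (@dq R) g) y.
  exact: iter_dq_euler_shift.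
rewrite [LHS](eq_on_iter_derive r _ _ _ E)// iter_dp_euler_shift//.
  by rewrite natrD opprD addrA addrAC.
exact: (Cinfty_pd 0 s).
Qed.

(** The product [(2 Y + c)_m] in coordinates; the factor with the largest shift acts first, in
    keeping with [op_pochS]. *)
Fixpoint euler_poch c m g : 'cV[R]_2 -> R :=
  if m is m'.+1 then euler_poch c m' (euler_shift (c + m'%:R) g) else g.

Lemma Cinfty_euler_poch c m g : Cinfty A g -> Cinfty A (euler_poch c m g).
Proof. by elim: m g => //= m IH g gs; apply: IH; exact: Cinfty_euler_shift. Qed.

Lemma op_pochS (Z : ('cV[R]_2 -> R) -> 'cV[R]_2 -> R) m f :
  op_poch Z m.+1 f = op_poch Z m (op_shift Z m%:R f).
Proof.
(* The last factor splits off because composition is a monoid law, whose axioms hold by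
   conversion. *)
rewrite /op_poch; pose M := Monoid.isLaw.Build _ idfun (@comp ('cV[R]_2 -> R) _ _)
  (fun _ _ _ => erefl) (fun _ => erefl) (fun _ => erefl).
pose L : Monoid.law idfun :=
  HB.pack (@comp ('cV[R]_2 -> R) ('cV[R]_2 -> R) ('cV[R]_2 -> R)) M.
by rewrite (@big_ord_recr _ _ L).
Qed.

(** [f] and [g] are kept apart since each step of the induction replaces them by functions known to
    agree on the half plane only. *)
Lemma op_pochE (k m : nat) f g x : (forall y, A y -> f y = g y) -> Cinfty A g ->
  A x -> op_poch (op_shift (op_scale 2 (@opY R)) k%:R) m f x = euler_poch k%:R m g x.
Proof.
elim: m f g x => [|m IH] f g x fg gs Ax.
  by rewrite /op_poch big_ord0 /= fg.
rewrite op_pochS; apply: IH => // [y Ay|]; last exact: Cinfty_euler_shift.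
rewrite /op_shift /op_scale /opY /op_scale mulVKf//.
rewrite (orbit_fieldHE _ _ g)//; last exact: Cinfty_diff gs Ay.
by rewrite /euler_shift fg//; ring.
Qed.

(** This is [opXE] with [phi = q^-k]: the powers of [q] already produced are constant along the
    lines of differentiation. *)
Lemma iter_opX k f g x : (forall y, A y -> f y = g y) -> Cinfty A g -> A x ->
  iter k (@opX R) f x = (x 1 0)^-1 ^+ k * iter k (@dp R) g x.
Proof.
move=> fg gs; elim: k x => [|k IH] x Ax; first by rewrite mul1r; exact: fg.
rewrite iterS (opXE _ (fun q => q^-1 ^+ k) _ _ _ IH)// ?mulrA ?exprSr//.
by apply: Cinfty_diff (Ax); exact: (Cinfty_pd k 0).
Qed.

(** Induction on [m], peeling off the factor with shift [k + m]: under a derivative of total order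
    [k + m] it becomes exactly minus the Euler operator, and Pascal's rule collects the terms. *)
Lemma iter_dp_euler_poch k m g x : Cinfty A g -> A x ->
  iter k (@dp R) (euler_poch k%:R m g) x = (-1) ^+ m * \sum_(i < m.+1)
    'C(m, i)%:R * x 0 0 ^+ (m - i) * x 1 0 ^+ i * pd (m - i + k) i g x.
Proof.
move=> + Ax; elim: m g => [|m IH] g gs.
  by rewrite big_ord1 /= bin0 subnn !expr0 !mulr1 !mul1r.
rewrite IH; last exact: Cinfty_euler_shift.
rewrite exprSr -mulrA; congr (_ * _); rewrite mulN1r -sumrN.
set p := x 0 0; set q := x 1 0.
pose a i := pd (m.+1 - i + k) i g x.
transitivity (\sum_(i < m.+1) - ('C(m, i)%:R * p ^+ (m.+1 - i) * q ^+ i * a i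
    + 'C(m, i)%:R * p ^+ (m - i) * q ^+ i.+1 * a i.+1)).
  apply: eq_bigr => -[i /= im] _; rewrite ltnS in im.
  rewrite pd_euler_shift// (_ : (m - i + k + i = k + m)%N); last by lia.
  rewrite natrD subrr /euler_shift mul0r sub0r dq_pd//.
  rewrite -/p -/q /a subSn// subSS addSn exprS exprS.
  rewrite -[dp _ x]/(pd (m - i + k).+1 i g x).
  move: (pd _ _ _ x) (pd _ _ _ x) => X Y; ring.
by rewrite !sumrN (sum_binS _ p q a m).
Qed.

End EulerOperators.

(** * The coefficients of the Rankin-Cohen brackets *)

Section Combinatorics.
Variable K : numFieldType.
Implicit Types p q : K.

Lemma bin_div_fact n k : (k <= n)%N ->
  'C(n, k)%:R / n`!%:R = (k`!%:R * (n - k)`!%:R)^-1 :> K.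
Proof.
move=> kn; rewrite -(bin_fact kn) !natrM [X in _ / X]mulrC invfM.
by rewrite mulrCA mulfV ?mulr1// pnatr_eq0 -lt0n bin_gt0.
Qed.

Lemma binE n k : (k <= n)%N ->
  'C(n, k)%:R = n`!%:R / (k`!%:R * (n - k)`!%:R) :> K.
Proof. by move=> kn; rewrite -bin_div_fact// mulrC divfK. Qed.

(** The binomial expansion of [(1 - 1)^n], divided by [n!]. *)
Lemma sum_sign_div_fact n :
  \sum_(k < n.+1) (-1) ^+ k / (k`!%:R * (n - k)`!%:R) = (n == 0)%:R :> K.
Proof.
transitivity ((1 - 1 : K) ^+ n / n`!%:R).
  rewrite exprDn mulr_suml; apply: eq_bigr => -[k kn] _ /=.
  by rewrite expr1n mul1r -[_ *+ 'C(_, _)]mulr_natr -mulrA bin_div_fact.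
by rewrite subrr expr0n; case: n => [|n] /=; rewrite ?mul0r// fact0 divr1.
Qed.

(** Only [j <= k <= n - i] contributes. With [k = l + j] and [N = n - i - j], factorials cancel and
    leave [p^N] times the sum of [sum_sign_div_fact] for [N]. *)
Lemma sum_sign_bin_bin p n i j : (i <= n)%N -> (j <= n)%N ->
  \sum_(k < n.+1) (-1) ^+ k / (k`!%:R * (n - k)`!%:R)
     * ('C(n - k, i)%:R * p ^+ (n - k - i)) * ('C(k, j)%:R * p ^+ (k - j))
  = (i + j == n)%N%:R * (-1) ^+ j / (i`!%:R * j`!%:R).
Proof.
move=> iN jN.
pose F k := (-1) ^+ k / (k`!%:R * (n - k)`!%:R)
     * ('C(n - k, i)%:R * p ^+ (n - k - i)) * ('C(k, j)%:R * p ^+ (k - j)).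
have F0 k : (k < j)%N || (n - k < i)%N -> F k = 0.
  by rewrite /F => /orP[] /bin_small ->; rewrite ?mul0r ?mulr0 ?mul0r.
case: (leqP (i + j) n) => [ijn|nij]; last first.
  rewrite gtn_eqF// !mul0r big1// => -[k kn] _; apply: (F0 k).
  by move: kn nij => /=; lia.
have [N nE] : exists N, n = (N + i + j)%N by exists (n - i - j)%N; lia.
rewrite -(big_mkord xpredT F).
rewrite (big_cat_nat (n := j)) //=; last by lia.
rewrite big_nat_cond big1 ?add0r => [|k /andP[/andP[_ kj] _]]; last by rewrite F0 ?kj.
rewrite (big_cat_nat (n := (j + N.+1)%N)) /=; [|by lia|by lia].
rewrite addrC big_nat_cond big1 ?add0r => [|k]; last first.
  by move=> /andP[/andP[k1 k2] _]; rewrite F0//; apply/orP; right; lia.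
rewrite -{1}[j]add0n big_addn addnC addnK big_mkord.
have -> : (i + j == n)%N = (N == 0)%N by lia.
(* [p^N] is the common factor of the summands; it is 1 for [N = 0], and otherwise both sides
   vanish. *)
have -> : (N == 0%N)%:R = p ^+ N * (N == 0%N)%:R.
  by case: (N) => [|N']; rewrite ?mul1r// mulr0.
have fu m : m`!%:R != 0 :> K by rewrite pnatr_eq0 -lt0n fact_gt0.
rewrite -sum_sign_div_fact mulr_sumr !mulr_suml.
apply: eq_bigr => -[l lN] _ /=; rewrite ltnS in lN; rewrite /F.
have -> : (n - (l + j) = N - l + i)%N by lia.
rewrite -(subnK lN) !addnK; move: (N - l)%N => r.
rewrite !binE ?leq_addl// !addnK !exprD.
by field; rewrite !fu.
Qed.

(* The coefficient of [a i * b j] is, up to sign and a power of [q], the sum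
   of [sum_sign_bin_bin], which vanishes unless [i + j = n]. *)
Lemma Rankin_Cohen_coefficients p q (a b : nat -> K) n : q != 0 ->
  \sum_(k < n.+1)
    (-1) ^+ k / k`!%:R
      * (q^-1 ^+ k * ((-1) ^+ (n - k) *
          \sum_(i < (n - k).+1) 'C(n - k, i)%:R * p ^+ (n - k - i) * q ^+ i * a i))
      * ((n - k)`!%:R^-1 * (q^-1 ^+ (n - k) * ((-1) ^+ k *
          \sum_(j < k.+1) 'C(k, j)%:R * p ^+ (k - j) * q ^+ j * b j)))
  = n`!%:R^-1 * \sum_(i < n.+1) (-1) ^+ i * 'C(n, i)%:R * a i * b (n - i)%N.
Proof.
move=> q0.
have fu m : m`!%:R != 0 :> K by rewrite pnatr_eq0 -lt0n fact_gt0.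
(* Vanishing binomials bring the inner sums to a common range, so that the summations can be
   exchanged. *)
have widen m (c : nat -> K) : (m <= n)%N ->
    \sum_(i < m.+1) 'C(m, i)%:R * p ^+ (m - i) * q ^+ i * c i
    = \sum_(i < n.+1) 'C(m, i)%:R * p ^+ (m - i) * q ^+ i * c i.
  move=> mn.
  rewrite (big_ord_widen n.+1 (fun i => 'C(m, i)%:R * p ^+ (m - i) * q ^+ i * c i))//.
  rewrite [RHS](bigID (fun i : 'I_n.+1 => (i < m.+1)%N)) /= [X in _ + X]big1 ?addr0//.
  by move=> i; rewrite -leqNgt => mi; rewrite bin_small// !mul0r.
transitivity (\sum_(k < n.+1) \sum_(i < n.+1) \sum_(j < n.+1)
   (-1) ^+ n * q^-1 ^+ n * (q ^+ i * q ^+ j) * (a i * b j) *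
   ((-1) ^+ k / (k`!%:R * (n - k)`!%:R)
     * ('C(n - k, i)%:R * p ^+ (n - k - i)) * ('C(k, j)%:R * p ^+ (k - j)))).
  apply: eq_bigr => -[k /= kn] _; rewrite ltnS in kn.
  rewrite !widen ?leq_subr//.
  transitivity ((-1) ^+ n * q^-1 ^+ n * ((-1) ^+ k / (k`!%:R * (n - k)`!%:R))
      * ((\sum_(i < n.+1) 'C(n - k, i)%:R * p ^+ (n - k - i) * q ^+ i * a i)
      * (\sum_(j < n.+1) 'C(k, j)%:R * p ^+ (k - j) * q ^+ j * b j))).
    move: (\sum_(i < _) _) (\sum_(i < _) _) => S1 S2.
    have powD c : c ^+ n = c ^+ (n - k) * c ^+ k :> K by rewrite -exprD subnK.
    rewrite (powD (-1)) (powD q^-1).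
    by field; rewrite !fu.
  rewrite big_distrlr mulr_sumr; apply: eq_bigr => i _.
  rewrite mulr_sumr; apply: eq_bigr => j _.
  move: (_ / _) ((-1) ^+ n) (q^-1 ^+ n) => X Y Z.
  by rewrite /=; ring.
rewrite exchange_big mulr_sumr; apply: eq_bigr => -[i /= iN] _; rewrite ltnS in iN.
rewrite exchange_big /=.
(* For fixed [i], the only surviving index [j] is [n - i]. *)
have ni : (n - i < n.+1)%N by lia.
rewrite (bigD1 (Ordinal ni)) //= -mulr_sumr sum_sign_bin_bin// ?leq_subr//.
rewrite subnKC// eqxx [X in _ + X]big1 ?addr0 => [|j jni]; last first.
  rewrite -mulr_sumr sum_sign_bin_bin//; last by rewrite -ltnS.
  rewrite (_ : (i + j == n)%N = false) ?mul0r ?mulr0//.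
  by apply: contraNF jni => /eqP ijn; apply/eqP/val_inj => /=; lia.
have -> : (-1) ^+ i * 'C(n, i)%:R = (-1) ^+ i * (n`!%:R / (i`!%:R * (n - i)`!%:R)) :> K.
  by rewrite binE.
rewrite -exprD subnKC// exprVn.
have -> : (-1) ^+ n = (-1) ^+ i * (-1) ^+ (n - i) :> K by rewrite -exprD subnKC.
(* With [j = n - i], the sign [(-1)^n (-1)^j] is [(-1)^i] times this square. *)
have s2 : (-1) ^+ (n - i) * (-1) ^+ (n - i) = 1 :> K by rewrite -expr2 sqrr_sign.
move: (q ^+ n) (expf_neq0 n q0) => Q Q0.
move: ((-1) ^+ (n - i)) s2 => s s2.
transitivity (s * s * (n`!%:R^-1 * ((-1) ^+ i * (n`!%:R / (i`!%:R * (n - i)`!%:R))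
   * a i * b (n - i)%N))); last by rewrite s2 mul1r.
by rewrite /=; field; rewrite Q0 !fu.
Qed.

End Combinatorics.

(** * Comparison of the two products, coefficient by coefficient *)

Theorem proposition3p4 (R : realType) (u v : 'cV[R]_2 -> R)
    (hu : Cinfty (@half_plane R) u) (hv : Cinfty (@half_plane R) v) :
  eq_hseries_on (@half_plane R) (RC_star u v) (moyal_star u v).
Proof.
move=> n x Ax; rewrite /RC_star /RC /moyal_star.
have q0 : x 1 0 != 0 by rewrite gt_eqF.
(* The [p]-order of the derivatives of [u] in the [k]-th term is [(n - k - i) + k = n - i], free of
   [k], and likewise for [v]: the same [a] and [b] serve every [k]. *)
pose a i := pd R (n - i) i u x; pose b j := pd R (n - j) j v x.
transitivity (n`!%:R^-1 * \sum_(i < n.+1) (-1) ^+ i * 'C(n, i)%:R * a i * b (n - i)%N).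
  rewrite -(Rankin_Cohen_coefficients _ (x 0 0) _ a b n q0).
  apply: eq_bigr => -[k /= kn] _; rewrite ltnS in kn.
  rewrite (iter_opX _ _ _ (euler_poch R k%:R (n - k) u))//; first last.
  - exact: Cinfty_euler_poch.
  - by move=> y Ay; exact: op_pochE.
  rewrite (iter_opX _ _ _ (euler_poch R (n - k)%:R k v))//; first last.
  - exact: Cinfty_euler_poch.
  - by move=> y Ay; exact: op_pochE.
  rewrite !iter_dp_euler_poch//.
  congr (_ * (_ * (_ * _)) * (_ * (_ * (_ * _)))); apply: eq_bigr => -[i /= ik] _.
    by rewrite /a (_ : (n - k - i + k = n - i)%N)//; lia.
  by rewrite /b (_ : (k - i + (n - k) = n - i)%N)//; lia.
congr (_ * _); apply: eq_bigr => -[i /= iN] _.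
by rewrite /a /b subKn.
Qed.
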